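(* Let $\mathcal H$ be a real separable Hilbert space and let $f:\mathcal H\to\mathbb R$ be convex and continuously differentiable with $L$-Lipschitz continuous gradient and $\mathcal S:=\operatorname{argmin}f\neq\emptyset$. Let $t_0>0$, $0<r<1$, and let $x:[t_0,+\infty)\to\mathcal H$ be a solution trajectory of $$\dot x(t)+\nabla f(x(t))+\frac1{t^r}x(t)=0.$$ Then $x(t)$ converges strongly, as $t\to+\infty$, to the minimum norm solution $x^\star=\operatorname{proj}_{\mathcal S}(0)$. Moreover, if $f\in\mathrm{EB}^p(\mathcal S)$ with $p\ge1$, then, as $t\to+\infty$, $$\|x(t)-x^\star\|^2=\begin{cases}\mathcal O\big(t^{-\frac rp}\big),&\text{if }r\in\big(0,\frac p{p+1}\big);\\[1mm]\mathcal O\big(t^{-(1-r)}\big),&\text{if }r\in\big[\frac p{p+1},1\big).\end{cases}$$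
   Context: $f\in\mathrm{EB}^p(\mathcal S)$ (Hölderian error bound with exponent $p\ge1$) means: there exist $\gamma>0$ and $\rho>\min f$ such that $f(x)-\min f\ge\gamma\operatorname{dist}(x,\mathcal S)^p$ for all $x\in\mathcal H$ with $\min f\le f(x)\le\rho$. $\operatorname{proj}_{\mathcal S}$ is the metric projection onto the closed convex set $\mathcal S$. *)

(* Defs.v *)
From HB Require Import structures.
From mathcomp Require Import all_boot all_order all_algebra sesquilinear.
From mathcomp Require Import all_classical all_reals all_analysis.

Set Implicit Arguments.
Unset Strict Implicit.
Unset Printing Implicit Defensive.

Import Order.TTheory GRing.Theory Num.Theory.
Import numFieldNormedType.Exports.

Local Open Scope classical_set_scope.
Local Open Scope ring_scope.

(* A real Hilbert space is a complete normed module [H] over [R : realType]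
   whose norm is induced by an inner product [dot]; [{dot H for idfun}] is the
   type of symmetric positive definite bilinear forms on [H]. *)
Definition norm_induced_by (R : realType) (H : normedModType R)
    (dot : {dot H for idfun}) :=
  forall u : H, `|u| = Num.sqrt (dot u u).

Definition separable (T : topologicalType) :=
  exists D : set T, countable D /\ dense D.

(* [gradf] is the gradient of the (Frechet differentiable) function [f]:
   [gradf u] is the Riesz representative of the differential of [f] at [u]. *)
Definition is_gradient (R : realType) (H : normedModType R)
    (dot : {dot H for idfun}) (f : H -> R) (gradf : H -> H) :=
  forall u : H, differentiable f u /\ forall v : H, 'd f u v = dot (gradf u) v.

Definition argmin (R : realType) (T : Type) (f : T -> R) : set T :=
  [set u | forall v, f u <= f v].

(* This is the minimum of [f] whenever [argmin f] is nonempty. *)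
Definition minval (R : realType) (T : Type) (f : T -> R) : R := inf (range f).

Definition dist (R : realType) (H : normedModType R) (u : H) (S : set H) : R :=
  inf [set `|u - v| | v in S].

Definition is_metric_proj (R : realType) (H : normedModType R)
    (S : set H) (u v : H) :=
  S v /\ forall w, S w -> `|u - v| <= `|u - w|.

(* The default value 0 is irrelevant when [S] is nonempty, closed and convex
   in a Hilbert space: the projection then exists and is unique. *)
Definition metric_proj (R : realType) (H : normedModType R)
    (S : set H) (u : H) : H :=
  xget 0 [set v | is_metric_proj S u v].

Definition holder_error_bound (R : realType) (H : normedModType R)
    (p : R) (f : H -> R) (S : set H) :=
  exists gamma rho : R, [/\ 0 < gamma, minval f < rho &
    forall u : H, minval f <= f u <= rho ->
      gamma * (dist u S) `^ p <= f u - minval f].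

(* Classical solution on [t0, +oo[ of  x' + grad f(x) + t^-r x = 0 : [x] is
   right-continuous at [t0] and satisfies the equation at every t > t0.  By
   continuity of the right-hand side, the equation then also holds at [t0] for
   the right derivative.  The values of [x] below [t0] are irrelevant. *)
Definition is_trajectory (R : realType) (H : normedModType R)
    (gradf : H -> H) (t0 r : R) (x : R -> H) :=
  derivable_oy_Rcontinuous x t0 /\
  forall t : R, t0 < t ->
    derive1 x t + gradf (x t) + (t `^ r)^-1 *: x t = 0.

(* Allows the Landau notation [g =O_ (pinfty_nbhs R) h]. *)
Canonical pinfty_filterType (R : numFieldType) :=
  FilterType (pinfty_nbhs R) (@proper_pinfty_nbhs R).

(* Main.v *)
(* Let v minimise f and put e(t) := t^-r, h(t) := |x(t) - v|^2.  Convexity gives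
     h' + e h <= 2 (f v - f x) + e (|v|^2 - |x|^2).
   When v has minimal norm in argmin f, the right-hand side is eventually at
   most e c for every c > 0, because a point of a sublevel set of level close to
   min f cannot have norm much smaller than |v|; comparison with a power of t
   gives h -> 0.  Under the error bound, a positive right-hand side forces
   gamma dist(x, argmin f)^p <= f x - f v <= e |v|^2 / 2, and |x| >= |v| - dist, so
   the right-hand side is O(e * e^(1/p)) and h = O(t^(-r/p)) for every r in ]0, 1[;
   this is at least the claimed rate when r >= p / (p + 1), as then 1 - r <= r / p. *)
Require Import Defs.
From mathcomp Require Import all_boot all_order all_algebra sesquilinear.
From mathcomp Require Import all_classical all_reals all_analysis.
From mathcomp Require Import ring lra.

Set Implicit Arguments.
Unset Strict Implicit.
Unset Printing Implicit Defensive.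

Import Order.TTheory GRing.Theory Num.Theory.
Import numFieldNormedType.Exports.

Local Open Scope classical_set_scope.
Local Open Scope ring_scope.

(** * A scalar differential inequality with coefficient t^-r *)

Lemma near_pinfty_ge_powR (R : realType) (K s : R) : 0 < s ->
  \forall t \near +oo, K <= t `^ s.
Proof.
move=> s0; near=> t.
apply: (@le_trans _ _ (Num.max K 0)); first by rewrite le_max lexx.
have K0 : 0 <= Num.max K 0 by rewrite le_max lexx orbT.
rewrite -[leLHS](powRr1 K0) -(mulVf (lt0r_neq0 s0)) powRrM.
apply: ge0_ler_powR; [exact: ltW|exact: powR_ge0|rewrite nnegrE|].
  by near: t; exact: nbhs_pinfty_ge.
by near: t; exact: nbhs_pinfty_ge.
Unshelve. all: end_near. Qed.

(** The function [c + A * t^-a] is a supersolution for large t: its derivative is of order t^(-a-1),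
    negligible against t^-r * t^-a because r < 1. Multiplying the difference with [h] by the
    integrating factor exp(t^(1-r) / (1-r)) gives a nonincreasing function. *)
Lemma gronwall_powR (R : realType) (h dh : R -> R) (r a c C : R) :
  r < 1 -> 0 <= a -> 0 <= C ->
  (\forall t \near +oo, is_derive (t : R) 1 h (dh t)) ->
  (\forall t \near +oo,
     dh t + t `^ (- r) * h t <= t `^ (- r) * (c + C * t `^ (- a))) ->
  exists A, \forall t \near +oo, h t <= c + A * t `^ (- a).
Proof.
move=> r1 a0 C0 hdh hle.
have r10 : 0 < 1 - r by rewrite subr_gt0.
(* The third bound ensures that the derivative of [A * t^-a] consumes at most half of the damping
   term [t^-r * A * t^-a]. *)
have [T [T0 hT]] : exists T : R, 0 < T /\ forall t, T <= t ->
    [/\ is_derive t 1 h (dh t),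
        dh t + t `^ (- r) * h t <= t `^ (- r) * (c + C * t `^ (- a)) &
        2 * a <= t `^ (1 - r)].
  have := near_pinfty_ge_powR (2 * a) r10.
  case: hdh => T1 [_ H1]; case: hle => T2 [_ H2] [T3 [_ H3]].
  exists (1 + Num.max 0 (Num.max T1 (Num.max T2 T3))).
  have M0 : 0 <= Num.max 0 (Num.max T1 (Num.max T2 T3)).
    by rewrite le_max lexx.
  split=> [|t]; first by rewrite ltr_pwDl.
  have [M1 M2 M3] : [/\ T1 <= Num.max 0 (Num.max T1 (Num.max T2 T3)),
     T2 <= Num.max 0 (Num.max T1 (Num.max T2 T3)) &
     T3 <= Num.max 0 (Num.max T1 (Num.max T2 T3))].
    by rewrite !le_max !lexx !orbT.
  by move=> Tt; split; [apply: H1|apply: H2|apply: H3] => /=; lra.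
(* [2 * C] lets the remaining half of the damping absorb [C]; the other entry makes the difference
   nonpositive at time [T]. *)
pose A := Num.max (2 * C) ((h T - c) * T `^ a).
have AC : 2 * C <= A by rewrite le_max lexx.
exists A.
pose G t := t `^ (1 - r) / (1 - r).
pose y t := h t - c - A * t `^ (- a).
pose z t := y t * expR (G t).
have dz t : T <= t -> is_derive t 1 z
    ((dh t + A * a * (t `^ (- a) / t) + t `^ (- r) * y t) * expR (G t)).
  move=> Tt; have [? _ _] := hT _ Tt.
  have t0 : 0 < t by exact: lt_le_trans Tt.
  have dp (b : R) : is_derive t 1 (fun s : R => s `^ b) (b * t `^ (b - 1)).
    exact: is_derive1_powR.
  have dG : is_derive t 1 G (t `^ (- r)).
    have -> : G = (1 - r)^-1 *: (fun s : R => s `^ (1 - r)).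
      by apply/funext => s; rewrite /G mulrC.
    apply: is_derive_eq (is_deriveZ _ (dp _)) _.
    by rewrite /GRing.scale/= mulKf ?lt0r_neq0// addrAC subrr add0r.
  have dy : is_derive t 1 y (dh t + A * a * (t `^ (- a) / t)).
    have -> : y = h - cst c - A *: (fun s : R => s `^ (- a)) by [].
    apply: is_derive_eq (is_deriveB (is_deriveB _ _) (is_deriveZ _ (dp _))) _.
    rewrite powRB ?(gt_eqF t0) ?implybT// powRr1 ?ltW// /GRing.scale/=.
    by ring.
  have dexpG : is_derive t 1 (expR \o G) (t `^ (- r) * expR (G t)).
    by apply: is_derive_eq (is_derive1_comp (is_derive_expR _) dG) _; rewrite mulrC.
  have -> : z = y * (expR \o G) by [].
  apply: is_derive_eq (is_deriveM dy dexpG) _.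
  rewrite /GRing.scale/=; ring.
have zle t : T <= t -> z t <= z T.
  move=> Tt; apply: (@ler0_derive1_nincry _ z T) => //.
  - move=> u; rewrite in_itv/= andbT => /ltW /dz du; exact: ex_derive.
  - move=> u; rewrite in_itv/= andbT => /ltW Tu.
    have := dz _ Tu; rewrite derive1E => du; rewrite derive_val.
    rewrite pmulr_lle0 ?expR_gt0//.
    have u0 : 0 < u by exact: lt_le_trans Tu.
    have [_ H1 H2] := hT _ Tu.
    have -> : u `^ (- a) / u = u `^ (- a) * u `^ (- r) / u `^ (1 - r).
      rewrite -mulrA -powRB ?(gt_eqF u0) ?implybT//.
      have -> : - r - (1 - r) = - 1 by ring.
      by rewrite powR_inv1// ltW.
    have P1 := powR_gt0 (- a) u0; have P2 := powR_gt0 (- r) u0.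
    have P3 := powR_gt0 (1 - r) u0.
    have Aa : A * (a / u `^ (1 - r)) <= A / 2.
      have A0 : 0 <= A by apply: le_trans AC; rewrite mulr_ge0.
      by rewrite ler_wpM2l// ler_pdivrMr// mulrC ler_pdivlMr// mulrC.
    have : u `^ (- a) * u `^ (- r) * (A * (a / u `^ (1 - r)) + C - A) <= 0.
      by rewrite pmulr_rle0 ?mulr_gt0//; lra.
    move=> H3; rewrite [leLHS](_ : _ =
      (dh u + u `^ (- r) * h u - u `^ (- r) * (c + C * u `^ (- a))) +
      u `^ (- a) * u `^ (- r) * (A * (a / u `^ (1 - r)) + C - A)).
      by rewrite -subr_le0 in H1; have := lerD H1 H3; rewrite addr0.
    by rewrite /y; ring.
  - apply: derivable_within_continuous => u.
    rewrite in_itv/= andbT => /dz du; exact: ex_derive.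
have zT : z T <= 0.
  rewrite pmulr_lle0 ?expR_gt0// /y.
  rewrite -addrA -opprD subr_le0 -lerBlDl -ler_pdivrMr ?powR_gt0//.
  by rewrite powRN invrK le_max lexx orbT.
exists T; split; first exact: num_real.
move=> t /ltW Tt; have := le_trans (zle _ Tt) zT.
by rewrite pmulr_lle0 ?expR_gt0// /y -addrA -opprD subr_le0.
Qed.

(** * Inner product calculus and the gradient inequality *)

Section hilbert.
Variables (R : realType) (H : normedModType R) (dot : {dot H for idfun}).
Hypothesis hdot : norm_induced_by dot.

Lemma dotvv u : dot u u = `|u| ^+ 2.
Proof.
rewrite hdot sqr_sqrtr//; have [->|/neq0_dnorm_gt0/ltW//] := eqVneq u 0.
by rewrite linear0r.
Qed.

Lemma dotC u v : dot u v = dot v u.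
Proof. by rewrite hermC expr0 mul1r. Qed.

Lemma dotDl u v w : dot (u + v) w = dot u w + dot v w.
Proof. exact: linearDl. Qed.

Lemma dotNl u w : dot (- u) w = - dot u w.
Proof. exact: linearNl. Qed.

Lemma dotZl a u w : dot (a *: u) w = a * dot u w.
Proof. exact: linearZl_LR. Qed.

Lemma dotBr u v w : dot u (v - w) = dot u v - dot u w.
Proof. exact: linearBr. Qed.

Lemma sqr_normD u v : `|u + v| ^+ 2 = `|u| ^+ 2 + 2 * dot u v + `|v| ^+ 2.
Proof. by rewrite -!dotvv linearDl !linearDr/= (dotC v u); ring. Qed.

Lemma sqr_normB u v : `|u - v| ^+ 2 = `|u| ^+ 2 - 2 * dot u v + `|v| ^+ 2.
Proof. by rewrite sqr_normD normrN linearNr mulrN. Qed.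

Lemma dot_polar u v : dot u v = (`|u + v| ^+ 2 - `|u - v| ^+ 2) / 4.
Proof. by rewrite sqr_normD sqr_normB; field. Qed.

(** Polarization reduces this to continuity of the norm. *)
Lemma cvg_dot (T : Type) (F : set_system T) {FF : Filter F} (a b : T -> H) u v :
  a @ F --> u -> b @ F --> v -> dot (a t) (b t) @[t --> F] --> dot u v.
Proof.
move=> au bv; rewrite dot_polar; under eq_fun do rewrite dot_polar.
apply: cvgM; last exact: cvg_cst.
apply: cvgB; rewrite expr2; under eq_fun do rewrite expr2.
  by apply: cvgM; apply: cvg_norm; exact: cvgD.
by apply: cvgM; apply: cvg_norm; exact: cvgB.
Qed.

(** By symmetry of [dot], the increment |a|^2 - |b|^2 equals [dot (a - b) (a + b)], so the
    difference quotient is an inner product of two convergent factors. *)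
Lemma is_derive_sqr_norm (y : R -> H) (t : R) (dy : H) :
  is_derive t 1 y dy -> is_derive t 1 (fun s => `|y s| ^+ 2) (2 * dot dy (y t)).
Proof.
move=> ydy.
have yc : {for t, continuous y}.
  by apply: differentiable_continuous; apply/derivable1_diffP; exact: ex_derive.
have : h^-1 *: ((fun s => `|y s| ^+ 2) (h + t) - `|y t| ^+ 2)
   @[h --> 0^'] --> 2 * dot dy (y t).
  have -> : 2 * dot dy (y t) = dot dy (y t + y t) by rewrite linearDr/=; ring.
  have E h : h^-1 *: (`|y (h + t)| ^+ 2 - `|y t| ^+ 2) =
      dot (h^-1 *: (y (h + t) - y t)) (y (h + t) + y t) :> R.
    rewrite -!dotvv linearZl_LR/= linearBl !linearDr/= (dotC (y t) (y (h + t))).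
    by rewrite /GRing.scale/=; ring.
  under eq_fun do rewrite E.
  apply: cvg_dot.
    have := @ex_derive _ _ _ _ _ _ _ ydy; rewrite /derivable.
    have := @derive_val _ _ _ _ _ _ _ ydy; rewrite /derive => <-.
    by rewrite /=; under eq_fun do rewrite [_%:A]mulr1.
  apply: cvgD; last exact: cvg_cst.
  have : h + t @[h --> 0^'] --> 0 + t.
    by apply: cvgD; [exact: nbhs_dnbhs|exact: cvg_cst].
  by rewrite add0r => /cvg_comp; apply.
move=> hl.
have E : (fun h : R => h^-1 *: (`|y (h%:A + t)| ^+ 2 - `|y t| ^+ 2)) =
    (fun h : R => h^-1 *: (`|y (h + t)| ^+ 2 - `|y t| ^+ 2)).
  by apply/funext => h; rewrite [h%:A]mulr1.
split; last by rewrite /derive/= E; exact: cvg_lim hl.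
by rewrite /derivable/= E; apply/cvg_ex; eexists; exact: hl.
Qed.

Lemma convex_functionP (f : H -> R) (t : R) (u v : H) :
  convex_function [set: convex_lmodType H] f -> 0 <= t <= 1 ->
  f (t *: u + (1 - t) *: v) <= t * f u + (1 - t) * f v.
Proof.
move=> cf /andP[t0 t1].
exact: (cf (Itv01 t0 t1) u v (mem_set I) (mem_set I)).
Qed.

(** By convexity the difference quotients in direction [v - u] with step in ]0, 1[ are at most
    [f v - f u]; the right limit keeps the bound. *)
Lemma gradient_le (f : H -> R) (gradf : H -> H) (u v : H) :
  convex_function [set: convex_lmodType H] f -> is_gradient dot f gradf ->
  f u + dot (gradf u) (v - u) <= f v.
Proof.
move=> cf /(_ u)[df grad]; rewrite -grad -deriveE//.
rewrite addrC -lerBrDr.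
have dv := @diff_derivable _ _ _ f u (v - u) df.
have /cvg_dnbhs_at_right hl := dv.
rewrite /derive -(cvg_lim _ hl)//.
apply: limr_le; first by apply/cvg_ex; eexists; exact: hl.
near=> h.
have h0 : 0 < h by [].
have h1 : h < 1 by near: h; exact: nbhs_right_lt.
have /(convex_functionP v u cf) : 0 <= h <= 1 by rewrite !ltW.
rewrite /= [_ *: (_ - _)]mulrC ler_pdivrMr//.
rewrite (_ : h *: v + _ = h *: (v - u) + u); first by lra.
by rewrite scalerBr scalerBl scale1r addrA addrAC.
Unshelve. all: end_near. Qed.
End hilbert.

(** * Minimal norm points of sublevel sets *)

(** This plays the part of weak compactness and weak lower semicontinuity of the norm. The infima
    [q n] of the squared norm over shrinking sublevel sets increase to a finite [M]; almost minimal
    points form a Cauchy sequence, and their limit [v] satisfies |v|^2 <= M. *)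
Lemma sublevel_min_norm (R : realType) (H : completeNormedModType R)
    (dot : {dot H for idfun}) (f : H -> R) (m : R) :
  norm_induced_by dot -> convex_function [set: convex_lmodType H] f ->
  continuous f -> (exists u, f u <= m) ->
  exists2 v, f v <= m & forall c, 0 < c ->
    exists2 eta, 0 < eta &
      forall u, f u <= m + eta -> `|v| ^+ 2 - c <= `|u| ^+ 2.
Proof.
move=> hdot cf fc [u0 fu0].
pose eta n : R := n.+1%:R^-1.
have eta0 n : 0 < eta n by rewrite invr_gt0.
have eta_cvg : eta @ \oo --> 0 by exact: cvg_harmonic.
have eta_le n k : (n <= k)%N -> eta k <= eta n.
  by move=> nk; rewrite lef_pV2 ?posrE ?ltr0n// ler_nat.
pose E n := [set `|u| ^+ 2 | u in [set u | f u <= m + eta n]].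
pose q n := inf (E n).
have fE u n : f u <= m + eta n -> q n <= `|u| ^+ 2.
  move=> fu; apply: ge_inf; last by exists u.
  by exists 0 => _ [w _ <-]; exact: sqr_ge0.
have hE n : has_inf (E n).
  split; first by exists (`|u0| ^+ 2), u0 => //; rewrite /= (le_trans fu0)// lerDl ltW.
  by exists 0 => _ [w _ <-]; exact: sqr_ge0.
have q_le n k : (n <= k)%N -> q n <= q k.
  move=> nk; apply: lb_le_inf; first by have [] := hE k.
  by move=> _ [w fw <-]; apply: fE; rewrite (le_trans fw)// lerD2l eta_le.
have /choice[u hu] n : exists w, f w <= m + eta n /\ `|w| ^+ 2 <= q n + eta n.
  have [_ [w fw <-] /ltW wq] := inf_adherent (eta0 n) (hE n).
  by exists w.
pose M := sup (range q).
have hM : has_sup (range q).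
  split; first by exists (q 0%N), 0%N.
  by exists (`|u0| ^+ 2) => _ [n _ <-]; apply: fE; rewrite (le_trans fu0)// lerDl ltW.
have qM n : q n <= M by apply: ub_le_sup; [have [] := hM|exists n].
have Mq e : 0 < e -> exists N, M - e < q N /\ eta N < e.
  move=> e0; have [_ [N1 _ <-] N1e] := sup_adherent e0 hM.
  have /cvgrPdist_lt/(_ _ e0)[N2 _ N2e] := eta_cvg.
  exists (maxn N1 N2); split.
    by apply: lt_le_trans N1e _; apply: q_le; exact: leq_maxl.
  have := N2e (maxn N1 N2) (leq_maxr _ _).
  by rewrite /= sub0r normrN gtr0_norm.
(* Parallelogram law: both squared norms are at most [M + eta N], and the midpoint stays in the
   [N]-th sublevel set, so its squared norm is at least [q N]. *)
have uc N n : (N <= n)%N -> `|u N - u n| ^+ 2 <= 4 * (M - q N + eta N).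
  move=> Nn; have [fN uN] := hu N; have [fn un] := hu n.
  have half01 : 0 <= (2^-1 : R) <= 1 by rewrite invr_ge0 ler0n/= invf_le1 ?ler1n.
  have /fE : f (2^-1 *: u N + (1 - 2^-1) *: u n) <= m + eta N.
    apply: le_trans (convex_functionP _ _ cf half01) _.
    have := eta_le _ _ Nn; lra.
  rewrite (_ : 1 - 2^-1 = 2^-1 :> R); last by field.
  rewrite -scalerDr normrZ exprMn gtr0_norm ?invr_gt0// (sqr_normD hdot).
  rewrite (sqr_normB hdot); have := eta_le _ _ Nn; have := qM N; have := qM n.
  lra.
have /cauchy_cvg/cvg_ex[v uv] : cauchy (u @ \oo).
  apply: cauchy_exP => e e0.
  (* Both [M - q N] and [eta N] will be below e^2 / 8, and [uc] multiplies their sum by 4. *)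
  have d0 : 0 < e ^+ 2 / 8 by rewrite divr_gt0// exprn_gt0.
  have [N [H1 H2]] := Mq _ d0.
  exists (u N), N => // n /= /uc le; rewrite -ball_normE/=.
  rewrite -(@ltr_pXn2r _ 2%N)// ?nnegrE// ?ltW//.
  apply: le_lt_trans le _; lra.
exists v => [|c c0].
  apply: (@ler_cvg_to _ \oo _ _ (f \o u) (fun n => m + eta n)).
  - by apply: continuous_cvg => //; exact: fc.
  - by rewrite -[X in _ --> X]addr0; apply: cvgD => //; exact: cvg_cst.
  - by apply: nearW => n; have [] := hu n.
have vM : `|v| ^+ 2 <= M.
  apply: (@ler_cvg_to _ \oo _ _ (fun n => `|u n| ^+ 2) (fun n => M + eta n)).
  - by rewrite expr2; under eq_fun do rewrite expr2; apply: cvgM; exact: cvg_norm.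
  - by rewrite -[X in _ --> X]addr0; apply: cvgD => //; exact: cvg_cst.
  - by apply: nearW => n; have [_ /le_trans] := hu n; apply; rewrite lerD2r.
have [N [H1 _]] := Mq _ c0.
exists (eta N) => // w /fE; lra.
Qed.

(** * Energy inequality and the effect of the error bound *)

Lemma minval_argmin (R : realType) (T : Type) (f : T -> R) (v : T) :
  argmin f v -> minval f = f v.
Proof.
move=> fv; apply/eqP; rewrite eq_le; apply/andP; split.
  by apply: ge_inf; [exists (f v) => _ [w _ <-]; exact: fv|exists v].
by apply: lb_le_inf; [exists (f v), v|move=> _ [w _ <-]; exact: fv].
Qed.

(** The identity 2 <x, x - v> = |x|^2 + |x - v|^2 - |v|^2 extracts the damping term from the
    Tikhonov term; [gradient_le] bounds the rest. *)
Lemma trajectory_energy (R : realType) (H : normedModType R)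
    (dot : {dot H for idfun}) (f : H -> R) (gradf : H -> H) (t0 r : R)
    (x : R -> H) (v : H) (t : R) :
  norm_induced_by dot -> convex_function [set: convex_lmodType H] f ->
  is_gradient dot f gradf -> is_trajectory gradf t0 r x -> t0 < t ->
  exists2 dh, is_derive t 1 (fun s => `|x s - v| ^+ 2) dh &
    dh + t `^ (- r) * `|x t - v| ^+ 2 <=
    2 * (f v - f (x t)) + t `^ (- r) * (`|v| ^+ 2 - `|x t| ^+ 2).
Proof.
move=> hdot cf fgrad [[xd _] xeq] t0t.
have dx : is_derive t 1 x (derive1 x t).
  by rewrite derive1E; apply: derivableP; apply: xd; rewrite in_itv/= t0t.
have dy : is_derive t 1 (fun s => x s - v) (derive1 x t).
  by apply: is_derive_eq (is_deriveB dx (is_derive_cst v t 1)) _; rewrite subr0.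
exists (2 * dot (derive1 x t) (x t - v)); first exact: (is_derive_sqr_norm hdot).
have -> : derive1 x t = - (gradf (x t) + t `^ (- r) *: x t).
  by apply/eqP; rewrite -addr_eq0 addrA powRN; apply/eqP; exact: xeq.
rewrite dotNl dotDl dotZl !dotBr (dotvv hdot) (sqr_normB hdot).
have := gradient_le (x t) v cf fgrad; rewrite dotBr.
move: (t `^ (- r)) => e; lra.
Qed.

(** The left-hand side is nonpositive unless |u| < |v| and the gap [f u - f v] is at most eps |v|^2
    / 2. Then |v|^2 - |u|^2 factors into |v| - |u|, at most the distance to [argmin f] since [v] has
    least norm there, and |v| + |u| <= 2 |v|. *)
Lemma error_bound_gap (R : realType) (H : normedModType R) (f : H -> R)
    (p gamma rho eps : R) (u v : H) :
  0 < p -> 0 < gamma -> is_metric_proj (argmin f) 0 v ->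
  (f u <= rho -> gamma * (dist u (argmin f)) `^ p <= f u - f v) ->
  0 < eps -> eps * `|v| ^+ 2 <= rho - f v ->
  2 * (f v - f u) + eps * (`|v| ^+ 2 - `|u| ^+ 2) <=
  eps * (2 * `|v| * (`|v| ^+ 2 / (2 * gamma)) `^ p^-1 * eps `^ p^-1).
Proof.
move=> p0 gamma0 [vS vmin] heb eps0 hrho.
have fvu : f v <= f u by exact: vS.
set K := (_ / _) `^ p^-1.
have K0 : 0 <= K by exact: powR_ge0.
have rhs0 : 0 <= 2 * `|v| * K * eps `^ p^-1 by rewrite !mulr_ge0// powR_ge0.
have [vu|uv] := leP `|v| `|u|.
  apply: (@le_trans _ _ 0); last by rewrite mulr_ge0// ltW.
  have : `|v| ^+ 2 <= `|u| ^+ 2 by rewrite lerXn2r// ?nnegrE.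
  nra.
have uge0 := sqr_ge0 `|u|.
have [fu|fu] := ltP (eps * `|v| ^+ 2) (2 * (f u - f v)).
  apply: (@le_trans _ _ 0); last by rewrite mulr_ge0// ltW.
  nra.
have fur : f u <= rho by lra.
have {}heb := heb fur.
have S0 : [set `|u - w| | w in argmin f] !=set0 by exists `|u - v|, v.
have d0 : 0 <= dist u (argmin f).
  by apply: lb_le_inf => // _ [w _ <-].
have dv : `|v| - `|u| <= dist u (argmin f).
  apply: lb_le_inf => // _ [w wS <-].
  have := vmin _ wS; rewrite !sub0r !normrN => vw.
  have := ler_normB u w; have := lerB_normD u w; have := lerB_dist w u.
  rewrite (distrC w u); lra.
(* The error bound gives dist^p <= eps |v|^2 / (2 gamma); take p-th roots. *)
have dK : dist u (argmin f) <= K * eps `^ p^-1.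
  have g0 : 0 <= `|v| ^+ 2 / (2 * gamma) by rewrite divr_ge0// mulr_ge0// ltW.
  rewrite /K -(powRM _ g0 (ltW eps0)).
  have dE : dist u (argmin f) = (dist u (argmin f) `^ p) `^ p^-1.
    by rewrite -powRrM mulfV ?lt0r_neq0// powRr1.
  rewrite [leLHS]dE.
  apply: ge0_ler_powR; rewrite ?invr_ge0 ?nnegrE ?powR_ge0 ?(ltW p0)//.
    by rewrite mulr_ge0// ltW.
  rewrite mulrAC ler_pdivlMr ?mulr_gt0//.
  lra.
move: (dist _ _) (eps `^ _) heb d0 dv dK rhs0 => d e _ d0 dv dK rhs0.
apply: (@le_trans _ _ (eps * (`|v| ^+ 2 - `|u| ^+ 2))); first by lra.
rewrite ler_wpM2l ?(ltW eps0)// subr_sqr.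
have : (`|v| - `|u|) * (`|v| + `|u|) <= K * e * (2 * `|v|).
  by rewrite ler_pM//; lra.
lra.
Qed.

(** * Strong convergence and rates *)

Theorem corollary4p13 (R : realType) (H : completeNormedModType R)
    (dot : {dot H for idfun}) (f : H -> R) (gradf : H -> H)
    (L t0 r : R) (x : R -> H)
    (hdot : norm_induced_by dot)
    (hsep : separable H)
    (fconvex : convex_function [set: convex_lmodType H] f)
    (fgrad : is_gradient dot f gradf)
    (gradf_cont : continuous gradf)
    (gradf_lip : L.-lipschitz_setT gradf)
    (argmin_nonempty : argmin f !=set0)
    (t0_gt0 : 0 < t0) (r_gt0 : 0 < r) (r_lt1 : r < 1)
    (xsol : is_trajectory gradf t0 r x) :
  let xstar := metric_proj (argmin f) 0 in
  [/\ is_metric_proj (argmin f) 0 xstar,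
      x t @[t --> +oo] --> xstar &
      forall p : R, 1 <= p -> holder_error_bound p f (argmin f) ->
        (r < p / (p + 1) ->
          (fun t => `|x t - xstar| ^+ 2) =O_ (pinfty_nbhs R)
            (fun t => t `^ (- (r / p)))) /\
        (p / (p + 1) <= r ->
          (fun t => `|x t - xstar| ^+ 2) =O_ (pinfty_nbhs R)
            (fun t => t `^ (- (1 - r))))].
Proof.
move=> xstar.
have fc : continuous f.
  by move=> u; apply: differentiable_continuous; have [] := fgrad u.
have [u0 u0min] := argmin_nonempty.
(* At the level [f u0] of a minimizer, the sublevel set is [argmin f] itself. *)
have [v fv hv] := sublevel_min_norm hdot fconvex fc (ex_intro _ u0 (lexx (f u0))).
have vmin : argmin f v by move=> w; exact: le_trans fv (u0min w).
have vproj : is_metric_proj (argmin f) 0 v.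
  split=> // w wmin; rewrite !sub0r !normrN.
  rewrite -(@ler_pXn2r _ 2%N) ?nnegrE//.
  apply/ler_addgt0Pr => c c0; have [eta eta0 heta] := hv _ c0.
  rewrite -lerBlDr; apply: heta.
  by apply: le_trans (wmin u0) _; rewrite lerDl ltW.
(* [v] witnesses that a projection exists, so [xget] does not return its default; bounds on [v] pass
   to [xstar] through |xstar| <= |v|. *)
have sproj : is_metric_proj (argmin f) 0 xstar by exact: xgetI vproj.
have smin : argmin f xstar by have [] := sproj.
have sv : `|xstar| <= `|v|.
  by have [_ /(_ _ vmin)] := sproj; rewrite !sub0r !normrN.
have /choice[dh hdh] t : exists dh, t0 < t ->
    is_derive t 1 (fun s => `|x s - xstar| ^+ 2) dh /\
    dh + t `^ (- r) * `|x t - xstar| ^+ 2 <=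
    2 * (f xstar - f (x t)) + t `^ (- r) * (`|xstar| ^+ 2 - `|x t| ^+ 2).
  have [t0t|_] := ltP t0 t; last by exists 0.
  by have [d h1 h2] := trajectory_energy xstar hdot fconvex fgrad xsol t0t; exists d.
have dhder : \forall t \near +oo,
    is_derive (t : R) 1 (fun s => `|x s - xstar| ^+ 2) (dh t).
  by apply: filterS (nbhs_pinfty_gt (num_real t0)) => t /hdh[].
have eps_small K e : 0 < e -> \forall t \near +oo, (t : R) `^ (- r) * K <= e.
  move=> e0; near=> t.
  have t_gt0 : 0 < t by near: t; exact: (nbhs_pinfty_gt (num_real _)).
  rewrite powRN mulrC ler_pdivrMr ?powR_gt0// mulrC -ler_pdivrMr//.
  by near: t; exact: near_pinfty_ge_powR.
have xcvg : x t @[t --> +oo] --> xstar.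
  apply/cvgrPdist_lt => e e0.
  (* One [c] comes from the comparison and one bounds the decaying remainder; 2 e^2 / 3 < e^2. *)
  pose c := e ^+ 2 / 3.
  have c0 : 0 < c by rewrite divr_gt0// exprn_gt0.
  have [eta eta0 heta] := hv _ c0.
  have [A hA] : exists A, \forall t \near +oo,
      `|x t - xstar| ^+ 2 <= c + A * t `^ (- r).
    apply: (gronwall_powR r_lt1 (ltW r_gt0) (lexx 0) dhder).
    near=> t.
    have t_gt0 : 0 < t by near: t; exact: (nbhs_pinfty_gt (num_real _)).
    have eps0 : 0 < t `^ (- r) by exact: powR_gt0.
    have /hdh[_ hle] : t0 < t by near: t; exact: (nbhs_pinfty_gt (num_real _)).
    apply: le_trans hle _; rewrite mul0r addr0.
    have sv2 : `|xstar| ^+ 2 <= `|v| ^+ 2 by rewrite lerXn2r// ?nnegrE.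
    have fsu : f xstar <= f (x t) by exact: smin.
    (* Near the minimal level, [heta] bounds |x|^2 below by |v|^2 - c; above it, the term -2 eta
       outweighs t^-r |v|^2. *)
    have [/heta|fx] := leP (f (x t)) (f u0 + eta); first by nra.
    have : t `^ (- r) * `|v| ^+ 2 <= eta by near: t; exact: eps_small.
    have := smin u0; have := sqr_ge0 `|x t|; nra.
  near=> t.
  rewrite distrC -(@ltr_pXn2r _ 2%N)// ?nnegrE// ?ltW//.
  apply: (@le_lt_trans _ _ (c + A * t `^ (- r))); first by near: t.
  have : t `^ (- r) * A <= c by near: t; exact: eps_small.
  rewrite /c; have := exprn_gt0 2 e0; lra.
split=> // p p1 [gamma [rho [gamma0 rho0 heb]]].
have p0 : 0 < p by exact: lt_le_trans p1.
rewrite (minval_argmin smin) in rho0 heb.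
have rate : exists A, \forall t \near +oo,
    `|x t - xstar| ^+ 2 <= A * t `^ (- (r / p)).
  (* This is the constant of [error_bound_gap] at eps = t^-r, where eps^(1/p) = t^(-r/p). *)
  pose C := 2 * `|xstar| * (`|xstar| ^+ 2 / (2 * gamma)) `^ p^-1.
  have C0 : 0 <= C by rewrite !mulr_ge0// powR_ge0.
  have rp0 : 0 <= r / p by rewrite divr_ge0// ltW.
  have [|A hA] := gronwall_powR (c := 0) r_lt1 rp0 C0 dhder; last first.
    by exists A; apply: filterS hA => t; rewrite add0r.
  near=> t.
  have t_gt0 : 0 < t by near: t; exact: (nbhs_pinfty_gt (num_real _)).
  have /hdh[_ hle] : t0 < t by near: t; exact: (nbhs_pinfty_gt (num_real _)).
  apply: le_trans hle _; rewrite add0r -[- (r / p)]mulNr powRrM.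
  apply: (error_bound_gap (rho := rho)) => //.
  - by move=> fx; apply: heb; rewrite fx andbT; exact: smin.
  - exact: powR_gt0.
  - by near: t; apply: eps_small; rewrite subr_gt0.
have rateO b : b <= r / p ->
    (fun t => `|x t - xstar| ^+ 2) =O_ (pinfty_nbhs R) (fun t => t `^ (- b)).
  move=> bp; have [A hA] := rate.
  (* The Landau constant must be positive, while the sign of [A] is unknown here. *)
  apply/eqO_exP; exists (Num.max 1 A); first by rewrite lt_max ltr01.
  near=> t.
  rewrite !ger0_norm ?powR_ge0 ?sqr_ge0//.
  apply: (@le_trans _ _ (A * t `^ (- (r / p)))); first by near: t.
  apply: (@le_trans _ _ (Num.max 1 A * t `^ (- (r / p)))).
    by rewrite ler_wpM2r ?powR_ge0// le_max lexx orbT.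
  have t1 : 1 <= t by near: t; exact: (nbhs_pinfty_ge (num_real _)).
  by rewrite ler_wpM2l ?le_max ?ler01// ler_powR// lerN2.
split=> hr; apply: rateO => //.
rewrite ler_pdivlMr//.
rewrite ler_pdivrMr in hr; last by rewrite addr_gt0.
lra.
Unshelve. all: end_near. Qed.
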